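(* For any $SSD(N,s_1s_2\cdots s_m)$, $$A_2\ \ge\ \frac{\left(\sum_{k=1}^m s_k-m\right)\left(\sum_{k=1}^m s_k-m-N+1\right)}{2(N-1)} .$$
   Context: $SSD(N,s_1s_2\cdots s_m)$ ($N\ge2$, $s_k\ge2$; the $s_k$ need not be equal) denotes an $N\times m$ matrix $D=[x_{ik}]$ whose $k$th column takes values in $\{0,1,\dots,s_k-1\}$ and which is balanced: in column $k$ each of the $s_k$ symbols appears exactly $N/s_k$ times. (SSD abbreviates ''supersaturated design''; only balanced ones are considered.) For each $k$ choose orthonormal contrasts on $\{0,\dots,s_k-1\}$, i.e. complex-valued functions $c^{(k)}_1,\dots,c^{(k)}_{s_k-1}$ with $\sum_x c^{(k)}_a(x)=0$ and $\sum_x c^{(k)}_a(x)\overline{c^{(k)}_b(x)}=s_k$ if $a=b$ and $0$ otherwise. Then $$A_2=A_2(D)=N^{-2}\sum_{1\le k<l\le m}\ \sum_{a=1}^{s_k-1}\sum_{b=1}^{s_l-1}\Big|\sum_{i=1}^N c^{(k)}_a(x_{ik})\,c^{(l)}_b(x_{il})\Big|^2 ,$$ which does not depend on the choice of orthonormal contrasts. *)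

(* Defs.v *)
From HB Require Import structures.
From mathcomp Require Import all_boot all_order all_algebra.
From mathcomp Require Import reals complex.
Set Implicit Arguments.
Unset Strict Implicit.
Unset Printing Implicit Defensive.
Import Order.TTheory GRing.Theory Num.Theory.
Local Open Scope ring_scope.

Definition balanced_design (N m : nat) (s : 'I_m -> nat)
    (D : 'I_N -> forall k : 'I_m, 'I_(s k)) : Prop :=
  forall k : 'I_m, (s k %| N)%N /\
    forall x : 'I_(s k), #|[set i : 'I_N | D i k == x]| = (N %/ s k)%N.

Definition orthonormal_contrasts (C : numClosedFieldType) (q : nat)
    (c : 'I_q.-1 -> 'I_q -> C) : Prop :=
  (forall a, \sum_x c a x = 0) /\
  (forall a b, \sum_x c a x * (c b x)^* = if a == b then q%:R else 0).

(* For orthonormal contrasts the value does not depend on their choice. It is an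
   element of C, where x <= y means that y - x is a nonnegative real number. *)
Definition A2 (C : numClosedFieldType) (N m : nat) (s : 'I_m -> nat)
    (c : forall k : 'I_m, 'I_(s k).-1 -> 'I_(s k) -> C)
    (D : 'I_N -> forall k : 'I_m, 'I_(s k)) : C :=
  N%:R ^- 2 * \sum_(k < m) \sum_(l < m | (k < l)%N)
    \sum_(a < (s k).-1) \sum_(b < (s l).-1)
      `|\sum_(i < N) c k a (D i k) * c l b (D i l)| ^+ 2.

(* Main.v *)
Require Import Defs.
From HB Require Import structures.
From mathcomp Require Import all_boot all_order all_algebra.
From mathcomp Require Import reals complex.
From mathcomp Require Import ring.
Set Implicit Arguments.
Unset Strict Implicit.
Unset Printing Implicit Defensive.
Import Order.TTheory GRing.Theory Num.Theory.
Local Open Scope ring_scope.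

(** Write [M] for the sum of the [s k - 1]. The orthonormal contrasts of a factor
    with [q] levels, together with the constant function 1, form a square matrix
    whose rows are orthogonal with squared norm [q]. Its columns then are so too,
    which gives [\sum_a c a x * (c a y)^* = q * (x == y) - 1]
    ([orthonormal_contrasts_kernel]).

    Expanding the squared moduli in [A2] therefore removes the contrasts: with
    [K k i j := s k * (D i k == D j k) - 1] and [T i j] the sum over [k] of
    [K k i j], the quantity [N ^ 2 * A2] is the sum over [i, j] of the products
    [K k i j * K l i j], [k < l], which is half of the difference between the
    sum of the [T i j ^ 2] and the sum of the [K k i j ^ 2]. By balance, each row
    [\sum_j K k i j ^ 2] equals [N * (s k - 1)], so the second sum is
    [N ^ 2 * M]. The matrix [T] has constant diagonal [M] and, again by balance,
    zero row sums; in each row the [N - 1] entries off the diagonal add up to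
    [- M], hence by convexity the sum of squares of the row is at least
    [M ^ 2 + M ^ 2 / (N - 1)] ([sum_sqr_row_ge]). *)

Lemma sqr_sum_ord (R : comPzRingType) (m : nat) (u : 'I_m -> R) :
  (\sum_k u k) ^+ 2 =
  \sum_k u k ^+ 2 + 2 * \sum_(k < m) \sum_(l < m | (k < l)%N) u k * u l.
Proof.
have -> : (\sum_k u k) ^+ 2 = \sum_(k < m) (u k ^+ 2
    + \sum_(l < m | (k < l)%N) u k * u l + \sum_(l < m | (l < k)%N) u k * u l).
  rewrite expr2 mulr_suml; apply: eq_bigr => k _; rewrite mulr_sumr.
  rewrite (bigD1 k) //= -expr2 -addrA; congr (_ + _).
  rewrite (bigID (fun l : 'I_m => (k < l)%N)) /=.
  by congr (_ + _); apply: eq_bigl => l; rewrite -val_eqE /=; case: ltngtP.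
rewrite !big_split /= -addrA mulr_natl mulr2n; congr (_ + (_ + _)).
rewrite (exchange_big_dep predT) //=; apply: eq_bigr => k _.
by apply: eq_bigr => l _; rewrite mulrC.
Qed.

Lemma sum_eq_indicator (R : pzSemiRingType) (I : finType) (P : pred I) :
  \sum_i (P i)%:R = #|[set i | P i]|%:R :> R.
Proof. by rewrite -natr_sum -sum1dep_card [in RHS]big_mkcond. Qed.

Lemma orthonormal_contrasts_kernel (C : numClosedFieldType) (q : nat)
    (c : 'I_q.-1 -> 'I_q -> C) :
  orthonormal_contrasts c ->
  forall x y, \sum_a c a x * (c a y)^* = q%:R * (x == y)%:R - 1.
Proof.
case: q c => [|q] c [sum_c ortho_c] x y; first by case: x.
pose U : 'M[C]_q.+1 :=
  \matrix_(r, z) (if unlift ord0 r is Some a then c a z else 1).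
pose V : 'M[C]_q.+1 := \matrix_(z, r) (U r z)^*.
have UV : U *m V = q.+1%:R%:M.
  apply/matrixP => r r'; rewrite !mxE.
  under eq_bigr => z _ do rewrite !mxE.
  case: (unliftP ord0 r) => [a ->|->]; case: (unliftP ord0 r') => [b ->|->].
  - by rewrite ortho_c (inj_eq lift_inj); case: eqP.
  - under eq_bigr => z _ do rewrite conjC1 mulr1.
    by rewrite sum_c eq_sym (negbTE (neq_lift _ _)).
  - under eq_bigr => z _ do rewrite mul1r.
    by rewrite -rmorph_sum sum_c rmorph0 (negbTE (neq_lift _ _)).
  - under eq_bigr => z _ do rewrite conjC1 mulr1.
    by rewrite sumr_const card_ord eqxx.
have q_neq0 : q.+1%:R != 0 :> C by rewrite pnatr_eq0.
have VU : V *m U = q.+1%:R%:M.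
  have /mulmx1C : U *m (q.+1%:R^-1 *: V) = 1%:M.
    by rewrite -scalemxAr UV scale_scalar_mx mulVf.
  by rewrite -scalemxAl => /(canRL (scalerKV q_neq0)) ->; rewrite scalemx1.
move/matrixP/(_ y x): VU; rewrite !mxE big_ord_recl !mxE unlift_none.
rewrite rmorph1 mulr1 eq_sym mulr_natr => <-; rewrite addrC addKr.
by apply: eq_bigr => a _; rewrite !mxE liftK mulrC.
Qed.

Section Coincidence.

Variables (C : numClosedFieldType) (N m : nat) (s : 'I_m -> nat).
Variable D : 'I_N -> forall k : 'I_m, 'I_(s k).

(** The reproducing kernel of the contrasts of factor [k], evaluated at the
    levels of that factor in runs [i] and [j]. *)
Definition coincidence (k : 'I_m) (i j : 'I_N) : C :=
  (s k)%:R * (D i k == D j k)%:R - 1.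

Lemma coincidence_real k i j : coincidence k i j \is Num.real.
Proof. by rewrite /coincidence -natrM rpredB ?realn ?real1. Qed.

Lemma coincidence_diag k i : coincidence k i i = (s k)%:R - 1.
Proof. by rewrite /coincidence eqxx mulr1. Qed.

Lemma sum_same_level (k : 'I_m) (i : 'I_N) : balanced_design D ->
  (s k)%:R * \sum_j (D i k == D j k)%:R = N%:R :> C.
Proof.
move=> balD; have [dvd_sN card_level] := balD k.
under eq_bigr => j _ do rewrite eq_sym.
by rewrite sum_eq_indicator card_level -natrM mulnC divnK.
Qed.

Lemma sum_coincidence k i : balanced_design D -> \sum_j coincidence k i j = 0.
Proof.
move=> balD; rewrite sumrB -mulr_sumr sum_same_level //.
by rewrite sumr_const card_ord subrr.
Qed.

Lemma sum_coincidence_sqr k i : balanced_design D ->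
  \sum_j coincidence k i j ^+ 2 = N%:R * ((s k)%:R - 1).
Proof.
move=> balD.
have -> : \sum_j coincidence k i j ^+ 2 =
    \sum_j (((s k)%:R - 1) * ((s k)%:R * (D i k == D j k)%:R)
             - coincidence k i j).
  by apply: eq_bigr => j _; rewrite /coincidence; case: (_ == _) => /=; ring.
by rewrite sumrB -!mulr_sumr sum_same_level // sum_coincidence // subr0 mulrC.
Qed.

Lemma sum_contrasts_sqr (c : forall k : 'I_m, 'I_(s k).-1 -> 'I_(s k) -> C) k l :
  (forall k, orthonormal_contrasts (c k)) ->
  \sum_a \sum_b `|\sum_i c k a (D i k) * c l b (D i l)| ^+ 2 =
  \sum_i \sum_j coincidence k i j * coincidence l i j.
Proof.
move=> hc.
have kernelE k' i j :
    coincidence k' i j = \sum_a c k' a (D i k') * (c k' a (D j k'))^*.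
  by rewrite orthonormal_contrasts_kernel.
under [RHS]eq_bigr => i _ do under eq_bigr => j _ do
  rewrite !kernelE big_distrlr /=.
under [RHS]eq_bigr => i _ do rewrite exchange_big /=.
rewrite [RHS]exchange_big /=; apply: eq_bigr => a _.
under [RHS]eq_bigr => i _ do rewrite exchange_big /=.
rewrite [RHS]exchange_big /=; apply: eq_bigr => b _.
rewrite normCK rmorph_sum big_distrlr /=.
by apply: eq_bigr => i _; apply: eq_bigr => j _; rewrite rmorphM /= mulrACA.
Qed.

Lemma A2_coincidence (c : forall k : 'I_m, 'I_(s k).-1 -> 'I_(s k) -> C) :
  (forall k, orthonormal_contrasts (c k)) ->
  2 * A2 c D = N%:R ^- 2 *
    \sum_i \sum_j ((\sum_k coincidence k i j) ^+ 2
                   - \sum_k coincidence k i j ^+ 2).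
Proof.
move=> hc; rewrite /A2 mulrCA; congr (_ * _).
under eq_bigr => k _ do under eq_bigr => l _ do rewrite sum_contrasts_sqr //.
under [RHS]eq_bigr => i _ do under eq_bigr => j _ do
  rewrite sqr_sum_ord addrC addKr.
under [RHS]eq_bigr => i _ do rewrite -mulr_sumr exchange_big /=.
rewrite -mulr_sumr [in RHS]exchange_big /=; congr (_ * _).
apply: eq_bigr => k _.
under [RHS]eq_bigr => i _ do rewrite exchange_big /=.
by rewrite [RHS]exchange_big.
Qed.

End Coincidence.

(** The mean of the entries other than [t i] is [- t i / (N - 1)]; the bound
    says that the sum of the squared deviations from this mean is nonnegative. *)
Lemma sum_sqr_row_ge (F : numFieldType) (N : nat) (t : 'I_N -> F) (i : 'I_N) :
  (1 < N)%N -> (forall j, t j \is Num.real) -> \sum_j t j = 0 ->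
  t i ^+ 2 * N%:R / (N%:R - 1) <= \sum_j t j ^+ 2.
Proof.
move=> N_gt1 t_real sum_t.
have N1_neq0 : N%:R - 1 != 0 :> F by rewrite subr_eq0 pnatr_eq1 gtn_eqF.
pose mu := - t i / (N%:R - 1).
have mu_real : mu \is Num.real.
  by rewrite rpredM ?rpredN ?rpredV ?rpredB ?realn ?real1.
have dev_ge0 : 0 <= \sum_(j | j != i) (t j - mu) ^+ 2.
  by apply: sumr_ge0 => j _; rewrite real_exprn_even_ge0 // rpredB.
rewrite -subr_ge0; move: dev_ge0; congr (is_true (0 <= _)).
have -> : \sum_(j | j != i) (t j - mu) ^+ 2 =
    \sum_j (t j ^+ 2 - 2 * mu * t j + mu ^+ 2) - (t i - mu) ^+ 2.
  rewrite [in RHS](bigD1 i) //=.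
  rewrite (_ : t i ^+ 2 - _ + _ = (t i - mu) ^+ 2); last by ring.
  by rewrite addrAC subrr add0r; apply: eq_bigr => j _; ring.
rewrite big_split sumrB /= -mulr_sumr sum_t mulr0 subr0 sumr_const card_ord.
rewrite -[mu ^+ 2 *+ N]mulr_natr /mu; field; exact: N1_neq0.
Qed.

Theorem theorem10 (R : realType) (N m : nat) (s : 'I_m -> nat)
    (D : 'I_N -> forall k : 'I_m, 'I_(s k))
    (c : forall k : 'I_m, 'I_(s k).-1 -> 'I_(s k) -> R[i])
    (hN : (2 <= N)%N) (hs : forall k : 'I_m, (2 <= s k)%N)
    (hD : balanced_design D)
    (hc : forall k : 'I_m, orthonormal_contrasts (c k)) :
  (\sum_(k < m) (s k)%:R - m%:R) * (\sum_(k < m) (s k)%:R - m%:R - N%:R + 1)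
    / (2 * (N%:R - 1)) <= A2 c D.
Proof.
set M : R[i] := \sum_(k < m) (s k)%:R - m%:R.
have ME : \sum_(k < m) ((s k)%:R - 1) = M.
  by rewrite sumrB sumr_const card_ord.
pose K := coincidence R[i] D.
have N_neq0 : N%:R != 0 :> R[i] by rewrite pnatr_eq0 -lt0n ltnW.
have N1_neq0 : N%:R - 1 != 0 :> R[i] by rewrite subr_eq0 pnatr_eq1 gtn_eqF.
rewrite -(ler_pM2l (ltr0n _ 2)) A2_coincidence //.
have row_ge i : M ^+ 2 * N%:R / (N%:R - 1) - N%:R * M <=
    \sum_j ((\sum_k K k i j) ^+ 2 - \sum_k K k i j ^+ 2).
  rewrite sumrB [X in _ <= _ - X]exchange_big /=.
  under [X in _ <= _ - X]eq_bigr => k _ do rewrite sum_coincidence_sqr //.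
  rewrite -mulr_sumr ME lerD2r.
  have diagE : \sum_k K k i i = M.
    by rewrite -ME; apply: eq_bigr => k _; exact: coincidence_diag.
  rewrite -[in X in X <= _]diagE.
  apply: (sum_sqr_row_ge (t := fun j => \sum_k K k i j)) => // [j|].
    by apply: rpred_sum => k _; exact: coincidence_real.
  by rewrite exchange_big big1 // => k _; exact: sum_coincidence.
have -> : 2 * (M * (M - N%:R + 1) / (2 * (N%:R - 1))) =
    N%:R ^- 2 * \sum_(i < N) (M ^+ 2 * N%:R / (N%:R - 1) - N%:R * M).
  rewrite sumr_const card_ord -[_ *+ N]mulr_natr; field.
  by rewrite N_neq0 N1_neq0.
rewrite ler_pM2l; first exact: ler_sum.
by rewrite invr_gt0 exprn_gt0 // ltr0n ltnW.
Qed.
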